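(* Suppose $(X,d)$ is a non-empty metric space. Let $\mathcal{S}(X)$ denote the collection of all non-empty finite subsets of $X$. For each $A$ and $B$ in $\mathcal{S}(X)$, define $f(A,B)$ on $\mathcal{S}(X)\times\mathcal{S}(X)$ to be the function \[ f(A,B)=\frac{1}{|A\cup B|\,|A|}\sum_{a\in A}\sum_{b\in B\setminus A}d(a,b)+\frac{1}{|A\cup B|\,|B|}\sum_{a\in A\setminus B}\sum_{b\in B}d(a,b). \] Then $f$ is a metric on $\mathcal{S}(X)$.
   Context: $|A|$ denotes the cardinality of the finite set $A$, and a sum over an empty index set is $0$. A function $d:Y\times Y\to\mathbb{R}$ is called a metric on a set $Y$ if for all $a,b,c\in Y$: (M1) $d(a,b)\geq 0$; (M2) $d(a,a)=0$; (M3) $d(a,b)=0$ implies $a=b$; (M4) $d(a,b)=d(b,a)$; (M5) $d(a,b)+d(b,c)\geq d(a,c)$. A metric space $(X,d)$ is a set $X$ with a metric $d$ on it. *)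

(* Defs.v *)
From HB Require Import structures.
From mathcomp Require Import all_boot all_order all_algebra.
From mathcomp Require Import finmap reals.

Set Implicit Arguments.
Unset Strict Implicit.
Unset Printing Implicit Defensive.

Import Order.TTheory GRing.Theory Num.Theory.

Local Open Scope fset_scope.
Local Open Scope ring_scope.

Record is_metric (R : realType) (Y : Type) (d : Y -> Y -> R) : Prop := IsMetric {
  metric_ge0 : forall a b, 0 <= d a b;
  metric_refl : forall a, d a a = 0;
  metric_sep : forall a b, d a b = 0 -> a = b;
  metric_sym : forall a b, d a b = d b a;
  metric_triangle : forall a b c, d a c <= d a b + d b c }.

(* Nonemptiness is a boolean condition, so equality in this subtype is equality
   of the underlying sets. *)
Definition nefset (X : choiceType) : Type := {A : {fset X} | A != fset0}.

Definition avg_dist (R : realType) (X : choiceType) (d : X -> X -> R)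
    (A' B' : nefset X) : R :=
  let A := val A' in let B := val B' in
  1 / (#|` A `|` B|%:R * #|` A|%:R)
    * (\sum_(a <- A) \sum_(b <- B `\` A) d a b)
  + 1 / (#|` A `|` B|%:R * #|` B|%:R)
    * (\sum_(a <- A `\` B) \sum_(b <- B) d a b).

(* Main.v *)
Require Import Defs.
From mathcomp Require Import all_boot all_order all_algebra.
From mathcomp Require Import finmap reals.

(** Order a finite set containing [A], [B] and [C] uniformly at random, and let
    [a], [b], [c] be the first elements of [A], [B], [C] in that order.  The
    first element [u] of [A `|` B] is uniform in [A `|` B]; if [u] is in both
    sets then [a = b = u], if it is only in [A] then [a = u] and [b] is uniform
    in [B], and symmetrically.  Hence the expectation of [d a b] is the average
    distance between [A] and [B] of the theorem, and the triangle inequality is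
    the expectation of [d a c <= d a b + d b c].

    The proof below carries this out without random orders, by conditioning on
    the first element of the order: [reveal A phi v] is the expectation of
    [phi a] once [v] is known to come first, and [mean_reveal] says that
    averaging it over the choice of [v] in any superset of [A] gives back the
    expectation of [phi a].  With [gap d A B v] the conditional expectation of
    [d a b] when [v] in [A `|` B] comes first, [avg_dist] is the mean of [gap]
    ([avg_distE]).  For the triangle inequality all three distances become
    means over [A `|` B `|` C], which are compared term by term.  The elements
    [v] lying in exactly one of the three sets fix one of [a], [b], [c]; for
    them one needs the inequality for a point and two sets ([point_le_dist],
    [dist_le_point]), which follows in the same way by revealing the first
    element of the union of the two sets. *)

Set Implicit Arguments.
Unset Strict Implicit.
Unset Printing Implicit Defensive.

Import Order.TTheory GRing.Theory Num.Theory.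

Local Open Scope fset_scope.
Local Open Scope ring_scope.

Definition mean (R : realType) (X : choiceType) (A : {fset X}) (phi : X -> R) : R :=
  (\sum_(a <- A) phi a) / #|` A|%:R.

Definition reveal (R : realType) (X : choiceType) (A : {fset X}) (phi : X -> R)
    (v : X) : R :=
  if v \in A then phi v else mean A phi.

(** Only the values on [A `|` B] are meaningful: at other points no
    representative is determined, and [reveal (A `|` B)] supplies the mean. *)
Definition gap (R : realType) (X : choiceType) (d : X -> X -> R) (A B : {fset X})
    (v : X) : R :=
  if v \in A then if v \in B then 0 else mean B (d v) else mean A (d v).

Definition mean_gap (R : realType) (X : choiceType) (d : X -> X -> R)
    (A B : {fset X}) : R :=
  mean (A `|` B) (gap d A B).

Lemma card_neq0 (R : realType) (X : choiceType) (A : {fset X}) :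
  A != fset0 -> #|` A|%:R != 0 :> R.
Proof. by rewrite pnatr_eq0 cardfs_eq0. Qed.

Lemma fsetU_neq0 (X : choiceType) (A B : {fset X}) :
  A != fset0 -> A `|` B != fset0.
Proof. by rewrite -!fproper0 => A0; apply: fproper_sub_trans A0 (fsubsetUl _ _). Qed.

Lemma sum_fsubset (R : realType) (X : choiceType) (A W : {fset X}) (phi : X -> R) :
  A `<=` W -> \sum_(v <- W) phi v = \sum_(v <- A) phi v + \sum_(v <- W `\` A) phi v.
Proof.
move=> /fsubsetP AW; rewrite (big_fsetID _ (mem A)) /=; congr (_ + _).
  by congr (\sum_(v <- enum_fset _) _); apply/fsetP=> v; rewrite !inE /= andb_idl //; exact: AW.
by congr (\sum_(v <- enum_fset _) _); apply/fsetP=> v; rewrite !inE /= andbC.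
Qed.

Lemma eq_mean (R : realType) (X : choiceType) (A : {fset X}) (phi psi : X -> R) :
  {in A, phi =1 psi} -> mean A phi = mean A psi.
Proof. by move=> e; congr (_ / _); apply: eq_big_seq. Qed.

Lemma le_mean (R : realType) (X : choiceType) (A : {fset X}) (phi psi : X -> R) :
  (forall v, v \in A -> phi v <= psi v) -> mean A phi <= mean A psi.
Proof.
move=> le; apply: ler_wpM2r; first by rewrite invr_ge0 ler0n.
by rewrite big_seq [leRHS]big_seq; apply: ler_sum => v /le.
Qed.

Lemma mean_cst (R : realType) (X : choiceType) (A : {fset X}) (c : R) :
  A != fset0 -> mean A (fun=> c) = c.
Proof.
move=> A0; rewrite /mean big_const_seq count_predT iter_addr addr0.
by rewrite -[c *+ _]mulr_natr mulfK ?card_neq0.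
Qed.

Lemma meanD (R : realType) (X : choiceType) (A : {fset X}) (phi psi : X -> R) :
  mean A (fun v => phi v + psi v) = mean A phi + mean A psi.
Proof. by rewrite /mean big_split mulrDl. Qed.

Lemma mean_ge0 (R : realType) (X : choiceType) (A : {fset X}) (phi : X -> R) :
  (forall v, v \in A -> 0 <= phi v) -> 0 <= mean A phi.
Proof.
by move=> p0; rewrite divr_ge0 ?ler0n // big_seq sumr_ge0 // => v /p0.
Qed.

Lemma mean_eq0 (R : realType) (X : choiceType) (A : {fset X}) (phi : X -> R) :
  (forall v, v \in A -> 0 <= phi v) -> mean A phi = 0 ->
  forall v, v \in A -> phi v = 0.
Proof.
move=> p0 /eqP m0 v vA.
have A0 : A != fset0 by apply/fset0Pn; exists v.
move: m0; rewrite mulf_eq0 invr_eq0 (negPf (card_neq0 R A0)) orbF.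
rewrite big_seq psumr_eq0 => [/allP/(_ v vA)|w /p0 //].
by rewrite vA => /eqP.
Qed.

(** Filling in the mean of [phi] outside [A] adds points to the average without
    moving it; this brings means over different sets to a common domain. *)
Lemma mean_reveal (R : realType) (X : choiceType) (A W : {fset X}) (phi : X -> R) :
  A != fset0 -> A `<=` W -> mean W (reveal A phi) = mean A phi.
Proof.
move=> A0 AW.
have W0 : W != fset0 by move: A0; rewrite -!fproper0 => /fproper_sub_trans; apply.
apply: (mulIf (card_neq0 R W0)); rewrite {1}/mean divfK ?card_neq0 //.
rewrite (sum_fsubset _ AW).
have -> : \sum_(v <- A) reveal A phi v = mean A phi * #|` A|%:R.
  rewrite divfK ?card_neq0 //; apply: eq_big_seq => v vA.
  by rewrite /reveal vA.
have -> : \sum_(v <- W `\` A) reveal A phi v = mean A phi * #|` W `\` A|%:R.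
  rewrite (eq_big_seq (fun=> mean A phi)) => [|v].
    by rewrite big_const_seq count_predT iter_addr addr0 mulr_natr.
  by rewrite inE /reveal => /andP[/negPf->].
rewrite -mulrDr -natrD cardfsD (fsetIidPr AW) subnKC //.
exact: fsubset_leq_card.
Qed.

(** Grouping the two double sums by the point of [A `|` B] outside [A `&` B]
    that they contain. *)
Lemma avg_distE (R : realType) (X : choiceType) (d : X -> X -> R) (A B : nefset X) :
  is_metric d -> avg_dist d A B = mean_gap d (val A) (val B).
Proof.
move=> hd; rewrite /avg_dist; move: (val A) (val B) => {}A {}B /=.
rewrite /mean_gap /mean (sum_fsubset _ (fsubsetUl A B)).
have -> : (A `|` B) `\` A = B `\` A.
  by apply/fsetP=> v; rewrite !inE; case: (v \in A).
rewrite (sum_fsubset (gap d A B) (fsubsetIl A B)).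
rewrite [X in X + _ + _]big1_seq ?add0r => [|v]; last first.
  by rewrite inE /gap => /andP[_ /andP[-> ->]].
have -> : A `\` (A `&` B) = A `\` B.
  by apply/fsetP=> v; rewrite !inE; case: (v \in A); rewrite /= ?andbF ?andbT.
have -> : \sum_(v <- A `\` B) gap d A B v = \sum_(v <- A `\` B) mean B (d v).
  by apply: eq_big_seq => v; rewrite inE /gap => /andP[/negPf-> ->].
have -> : \sum_(v <- B `\` A) gap d A B v = \sum_(v <- B `\` A) mean A (d v).
  by apply: eq_big_seq => v; rewrite inE /gap => /andP[/negPf->].
rewrite /mean -!mulr_suml exchange_big /= !invfM !mul1r mulrDl addrC.
congr (_ + _); first by rewrite mulrC mulrA mulrAC.
rewrite [LHS]mulrC mulrA mulrAC; congr (_ * _ * _).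
by apply: eq_bigr => v _; apply: eq_bigr => a _; apply: metric_sym hd _ _.
Qed.

Lemma gap_ge0 (R : realType) (X : choiceType) (d : X -> X -> R) (A B : {fset X})
    (v : X) :
  is_metric d -> 0 <= gap d A B v.
Proof.
move=> hd; rewrite /gap.
by case: ifP => _; [case: ifP => // _|]; apply: mean_ge0 => w _; apply: metric_ge0 hd _ _.
Qed.

Lemma mean_gapC (R : realType) (X : choiceType) (d : X -> X -> R) (A B : {fset X}) :
  mean_gap d A B = mean_gap d B A.
Proof.
rewrite /mean_gap fsetUC; apply: eq_mean => v.
by rewrite inE /gap; case: (v \in A); case: (v \in B).
Qed.

Lemma mean_gap_eq0_sub (R : realType) (X : choiceType) (d : X -> X -> R)
    (A B : {fset X}) :
  is_metric d -> B != fset0 -> mean_gap d A B = 0 -> A `<=` B.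
Proof.
move=> hd /fset0Pn[b bB] g0; apply/fsubsetP=> v vA; apply/negPn/negP=> vB.
have := mean_eq0 (fun w _ => gap_ge0 A B w hd) g0 (v := v).
rewrite inE vA /gap vA (negPf vB) => /(_ isT) m0.
have := mean_eq0 (fun w _ => metric_ge0 hd v w) m0 bB.
by move/(metric_sep hd) => vb; rewrite vb bB in vB.
Qed.

Lemma mean_dist_triangle (R : realType) (X : choiceType) (d : X -> X -> R)
    (A : {fset X}) (u v : X) :
  is_metric d -> A != fset0 -> mean A (d u) <= d u v + mean A (d v).
Proof.
move=> hd A0; rewrite -{1}(mean_cst (d u v) A0) -meanD.
by apply: le_mean => w _; apply: metric_triangle hd _ _ _.
Qed.

Lemma dist_mean_triangle (R : realType) (X : choiceType) (d : X -> X -> R)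
    (A : {fset X}) (u v : X) :
  is_metric d -> A != fset0 -> d u v <= mean A (d u) + mean A (d v).
Proof.
move=> hd A0; rewrite -{1}(mean_cst (d u v) A0) -meanD.
by apply: le_mean => w _; rewrite (metric_sym hd v); apply: metric_triangle hd _ _ _.
Qed.

(** This is the case where the representative of the first set is already known
    to be [u].  Revealing the first element of [B `|` C] fixes at least one of
    the other two, and what remains is the triangle inequality of [d], averaged
    over the third. *)
Lemma point_le_dist (R : realType) (X : choiceType) (d : X -> X -> R)
    (B C : {fset X}) (u : X) :
  is_metric d -> B != fset0 -> C != fset0 ->
  mean C (d u) <= mean B (d u) + mean_gap d B C.
Proof.
move=> hd B0 C0.
rewrite -(mean_reveal _ C0 (fsubsetUr B C)) -(mean_reveal _ B0 (fsubsetUl B C)) -meanD.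
apply: le_mean => v; rewrite inE /reveal /gap.
case: (v \in B) (v \in C) => -[] //= _.
- by rewrite addr0.
- exact: mean_dist_triangle.
- exact: dist_mean_triangle.
Qed.

(** Here it is the representative of the intermediate set that is known to be
    [u]; the first element of [A `|` C] is revealed as in [point_le_dist]. *)
Lemma dist_le_point (R : realType) (X : choiceType) (d : X -> X -> R)
    (A C : {fset X}) (u : X) :
  is_metric d -> A != fset0 -> C != fset0 ->
  mean_gap d A C <= mean A (d u) + mean C (d u).
Proof.
move=> hd A0 C0.
rewrite -(mean_reveal _ A0 (fsubsetUl A C)) -(mean_reveal _ C0 (fsubsetUr A C)) -meanD.
apply: le_mean => v; rewrite inE /reveal /gap.
case: (v \in A) (v \in C) => -[] //= _.
- by rewrite addr_ge0 ?(metric_ge0 hd).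
- by rewrite (metric_sym hd u); apply: mean_dist_triangle.
- by rewrite addrC (metric_sym hd u); apply: mean_dist_triangle.
Qed.

(** Both sides are averages over the first element [v] of [A `|` B `|` C].  If
    [v] lies in at least two of the sets the terms cancel or are nonnegative; if it lies
    in only one, that set is replaced by the point [v]. *)
Lemma mean_gap_triangle (R : realType) (X : choiceType) (d : X -> X -> R)
    (A B C : {fset X}) :
  is_metric d -> A != fset0 -> B != fset0 -> C != fset0 ->
  mean_gap d A C <= mean_gap d A B + mean_gap d B C.
Proof.
move=> hd A0 B0 C0; pose W := A `|` B `|` C.
have onW P Q : P != fset0 -> P `|` Q `<=` W ->
    mean_gap d P Q = mean W (reveal (P `|` Q) (gap d P Q)).
  by move=> P0 sW; rewrite mean_reveal // fsetU_neq0.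
rewrite (onW A B) ?fsubsetUl // (onW B C) //; last first.
  by rewrite /W -fsetUA fsubsetUr.
rewrite (onW A C) //; last first.
  by apply/fsubsetP=> v; rewrite !inE => /orP[] ->; rewrite ?orbT.
rewrite -meanD; apply: le_mean => v; rewrite !inE /reveal !inE -!/(mean_gap _ _ _).
have m0 P : 0 <= mean P (d v) by apply: mean_ge0 => w _; apply: metric_ge0 hd _ _.
rewrite /gap; case: (v \in A) (v \in B) (v \in C) => -[] [] //= _.
- by rewrite addr0.
- by rewrite add0r.
- by rewrite addr_ge0.
- exact: point_le_dist.
- by rewrite addr0.
- exact: dist_le_point.
- by rewrite addrC mean_gapC; apply: point_le_dist.
Qed.

Theorem theorem3 (R : realType) (X : choiceType) (d : X -> X -> R)
  (hX : inhabited X) (hd : is_metric d) :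
  is_metric (@avg_dist R X d).
Proof.
have E A B := avg_distE A B hd.
split=> [A B|A|A B|A B|A B C]; rewrite ?E.
- by apply: mean_ge0 => v _; apply: gap_ge0.
- rewrite /mean_gap (@eq_mean _ _ _ _ (fun=> 0)) => [|v].
    by rewrite mean_cst // fsetU_neq0 // (valP A).
  by rewrite inE orbb /gap => ->.
- move=> g0; apply/val_inj/eqP; rewrite eqEfsubset.
  rewrite (mean_gap_eq0_sub hd (valP B) g0).
  by rewrite (mean_gap_eq0_sub hd (valP A)) // mean_gapC.
- exact: mean_gapC.
- exact: mean_gap_triangle hd (valP A) (valP B) (valP C).
Qed.
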